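(* Fix $c>0$, $\rho>0$, $l_0\ge1$, $\alpha\in(0,1)$ and define $$\mathrm{GE}_\alpha(v)=\sup\left\{s\ge0:\ m(s,v)<\frac{l_0}{\alpha}\right\},$$ $$m(s,v)=\frac{\left(\frac{\rho}{c^2}\right)^{\rho/c^2}}{\Gamma\left(\frac{\rho}{c^2}\right)\gamma\left(\frac{\rho}{c^2},\frac{\rho}{c^2}\right)}\cdot\frac{\Gamma\left(\frac{v+\rho}{c^2}\right)\gamma\left(\frac{v+\rho}{c^2},\frac{cs+v+\rho}{c^2}\right)}{\left(\frac{cs+v+\rho}{c^2}\right)^{(v+\rho)/c^2}}\exp\left\{\frac{cs+v}{c^2}\right\}.$$ Then $\mathrm{GE}_\alpha$ is an $l_0$-sub-exponential uniform boundary with crossing probability $\alpha$ for scale $c$.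
   Context: $\gamma(a,x)=\left(\int_0^xu^{a-1}e^{-u}\,du\right)/\Gamma(a)$ is the regularized lower incomplete gamma function. Sub-$\psi$ condition: let $(S_t)_{t=0}^\infty$, $(V_t)_{t=0}^\infty$ be real-valued processes adapted to a filtration $(\mathcal F_t)_{t=0}^\infty$ with $S_0=V_0=0$ and $V_t\ge 0$ for all $t$. For $\psi:[0,\lambda_{\max})\to\mathbb{R}$ and $l_0\in[1,\infty)$, $(S_t)$ is $l_0$-sub-$\psi$ with variance process $(V_t)$ if for each $\lambda\in[0,\lambda_{\max})$ there is a supermartingale $(L_t(\lambda))_{t=0}^\infty$ with respect to $(\mathcal F_t)$ with $\mathbb{E}L_0(\lambda)\le l_0$ and $\exp\{\lambda S_t-\psi(\lambda)V_t\}\le L_t(\lambda)$ a.s. for all $t$. Uniform boundary: $u$ is an $l_0$-sub-$\psi$ uniform boundary with crossing probability $\alpha$ if $\mathbb{P}(\exists t\ge 1: S_t\ge u(V_t))\le\alpha$ for every pair $(S_t,V_t)$ such that $(S_t)$ is $l_0$-sub-$\psi$ with variance process $(V_t)$. Sub-exponential with scale $c>0$ means sub-$\psi$ with $\psi(\lambda)=\psi_{E,c}(\lambda)=c^{-2}(-\log(1-c\lambda)-c\lambda)$ on $0\le\lambda<1/c$. *)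

(* Defs.v *)
From HB Require Import structures.
From mathcomp Require Import all_boot all_order all_algebra.
From mathcomp Require Import all_classical all_reals all_analysis.
Import Order.TTheory GRing.Theory Num.Theory.
Import numFieldNormedType.Exports.

Set Implicit Arguments.
Unset Strict Implicit.
Unset Printing Implicit Defensive.

Local Open Scope classical_set_scope.
Local Open Scope ring_scope.

Definition Gamma (R : realType) (a : R) : R :=
  \int[lebesgue_measure]_(u in `]0, +oo[) (u `^ (a - 1) * expR (- u)).

Definition gamma_reg (R : realType) (a x : R) : R :=
  (\int[lebesgue_measure]_(u in `]0, x[) (u `^ (a - 1) * expR (- u))) / Gamma a.

Section processes.
Context d (T : measurableType d) (R : realType) (P : probability T R).

Definition filtration (F : nat -> set_system T) : Prop :=
  [/\ forall t, sigma_algebra setT (F t),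
      forall t, F t `<=` measurable
    & forall s t, (s <= t)%N -> F s `<=` F t].

Definition measurable_wrt (G : set_system T) (X : T -> R) : Prop :=
  preimage_set_system setT X measurable `<=` G.

Definition adapted (F : nat -> set_system T) (X : nat -> T -> R) : Prop :=
  forall t, measurable_wrt (F t) (X t).

(* Y is a version of E[X | G] *)
Definition is_cond_exp (G : set_system T) (X Y : T -> R) : Prop :=
  [/\ measurable_wrt G Y, P.-integrable setT (EFin \o Y)
    & forall A, G A ->
        (\int[P]_(w in A) (Y w)%:E = \int[P]_(w in A) (X w)%:E)%E].

(* A version of E[L_(t+1) | F_t] exists and any two agree almost surely, so the
   existential expresses E[L_(t+1) | F_t] <= L_t a.s. *)
Definition supermartingale (F : nat -> set_system T) (L : nat -> T -> R)
    : Prop :=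
  [/\ adapted F L, forall t, P.-integrable setT (EFin \o L t)
    & forall t, exists2 Y, is_cond_exp (F t) (L t.+1) Y
                         & {ae P, forall w, Y w <= L t w}].

(* psi is only evaluated on [0, lmax[; lmax may be +oo. *)
Definition sub_psi (psi : R -> R) (lmax : \bar R) (l0 : R)
    (F : nat -> set_system T) (S V : nat -> T -> R) : Prop :=
  [/\ filtration F, adapted F S /\ adapted F V,
      forall w, S 0%N w = 0 /\ V 0%N w = 0,
      forall t w, 0 <= V t w
    & forall l : R, 0 <= l -> (l%:E < lmax)%E ->
        exists L : nat -> T -> R,
          [/\ supermartingale F L, ('E_P[L 0%N] <= l0%:E)%E
            & forall t,
                {ae P, forall w,
                   expR (l * S t w - psi l * V t w) <= L t w}]].

End processes.

(* Measures take unspecified values on nonmeasurable sets, so that the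
   crossing event is measurable is part of P(...) <= alpha. *)
Definition uniform_boundary (R : realType) (psi : R -> R) (lmax : \bar R)
    (l0 alpha : R) (u : R -> R) : Prop :=
  forall (d : measure_display) (T : measurableType d) (P : probability T R)
         (F : nat -> set_system T) (S V : nat -> T -> R),
    sub_psi P psi lmax l0 F S V ->
    let crossing := [set w | exists2 t, (1 <= t)%N & u (V t w) <= S t w] in
    measurable crossing /\ (P crossing <= alpha%:E)%E.

Definition psi_E (R : realType) (c l : R) : R :=
  c ^- 2 * (- ln (1 - c * l) - c * l).

Definition sub_exponential_uniform_boundary (R : realType)
    (c l0 alpha : R) (u : R -> R) : Prop :=
  uniform_boundary (psi_E c) (c^-1)%:E l0 alpha u.

Definition GE_mix (R : realType) (c rho s v : R) : R :=
  (rho / c ^+ 2) `^ (rho / c ^+ 2)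
    / (Gamma (rho / c ^+ 2) * gamma_reg (rho / c ^+ 2) (rho / c ^+ 2))
  * (Gamma ((v + rho) / c ^+ 2)
       * gamma_reg ((v + rho) / c ^+ 2) ((c * s + v + rho) / c ^+ 2)
     / ((c * s + v + rho) / c ^+ 2) `^ ((v + rho) / c ^+ 2))
  * expR ((c * s + v) / c ^+ 2).

(* For v >= 0 the set is nonempty (it contains 0) and bounded above, since
   GE_mix c rho s v increases to +oo in s; hence sup is the true supremum. *)
Definition GE (R : realType) (c rho l0 alpha v : R) : R :=
  sup [set s | 0 <= s /\ GE_mix c rho s v < l0 / alpha].

(* Main.v *)
(* Put u = 1 - c lambda, so that lambda in [0, 1/c) corresponds to u in ]0, 1].
   Rescaling the incomplete gamma integrals shows that GE_mix is the mixture
   m(s, v) = int_0^1 exp(lambda s - psi(lambda) v) w(u) du for a probability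
   density w proportional to u^(rho/c^2 - 1) e^(-(rho/c^2) u).  It increases to
   +oo continuously in s and decreases in v, so GE_alpha is monotone in v, hence
   measurable, and S_t >= GE_alpha(V_t) forces m(S_t, V_t) >= l0/alpha.

   The dominating supermartingales L(lambda) need not depend measurably on
   lambda, so they cannot be integrated against w.  Instead w is discretized on
   the mesh 1/n with tags at right endpoints: the finite mixture dominates
   exp(-(S_t/c + V_t/c^2)/n) m(S_t, V_t) and is itself dominated by a finite
   combination of supermartingales, to which Ville's inequality applies.  On the
   event S_t/c + V_t/c^2 <= k let n tend to infinity, and then k. *)
Require Import Defs.
From HB Require Import structures.
From mathcomp Require Import all_boot all_order all_algebra.
From mathcomp Require Import all_classical all_reals all_analysis.
From mathcomp Require Import measurable_realfun ring lra.
Import Order.TTheory GRing.Theory Num.Theory.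
Import numFieldNormedType.Exports.

Set Implicit Arguments.
Unset Strict Implicit.
Unset Printing Implicit Defensive.

Local Open Scope ring_scope.
Local Open Scope classical_set_scope.

(** * Incomplete gamma integrals *)

Lemma integrable_EFinZl {d} {T : measurableType d} {R : realType}
    (mu : {measure set T -> \bar R}) (D : set T) (r : R) (f : T -> R) :
  measurable D -> mu.-integrable D (EFin \o f) ->
  mu.-integrable D (EFin \o (fun x => r * f x)).
Proof. by move=> mD; exact: integrableZl. Qed.

Lemma integrable_disjU {d} {T : measurableType d} {R : realType}
    (mu : {measure set T -> \bar R}) (A B : set T) (f : T -> \bar R) :
  measurable A -> measurable B -> [disjoint A & B] ->
  mu.-integrable A f -> mu.-integrable B f -> mu.-integrable (A `|` B) f.
Proof.
move=> mA mB AB /integrableP[mAf iA] /integrableP[mBf iB].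
have mABf : measurable_fun (A `|` B) f by exact/measurable_funU.
apply/integrableP; split => //; rewrite ge0_integral_setU//.
- exact: lte_add_pinfty.
- exact: measurableT_comp.
Qed.

Section incomplete_gamma.
Context {R : realType}.
Notation mu := (@lebesgue_measure R).
Implicit Types a b x u : R.

Lemma continuous_powR_gt0 a u : 0 < u -> {for u, continuous (@powR R ^~ a)}.
Proof.
move=> u0; apply/differentiable_continuous/derivable1_diffP.
by apply: derivable_powR; rewrite in_itv/= u0.
Qed.

(** For [a < 1] the integrand is singular at 0, so the antiderivative [u^a / a] is used on intervals
    bounded away from 0. Each integral there is at most [1 / a], and monotone convergence carries
    the bound to []0, 1]]. *)
Lemma integrable_powR01 a : 0 < a ->
  mu.-integrable `]0, 1] (EFin \o (@powR R ^~ (a - 1))).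
Proof.
move=> a0; have mp D : measurable_fun D (EFin \o (@powR R ^~ (a - 1))).
  by apply/measurable_EFinP/measurable_funTS; exact: measurable_powR.
apply/integrableP; split; first exact: mp.
under eq_integral do rewrite /= ger0_norm ?powR_ge0//.
(* With [n.+2] the left endpoint is below 1 already at [n = 0], as the fundamental theorem of
   calculus requires. *)
pose F n : set R := `[n.+2%:R^-1, 1].
have -> : `]0, 1] = \bigcup_n F n.
  apply/seteqP; split => u /=; last first.
    move=> [n _]; rewrite /F/= !in_itv/= => /andP[nu ->].
    by rewrite andbT (lt_le_trans _ nu).
  rewrite in_itv/= => /andP[u0 u1].
  exists (Num.truncn u^-1) => //; rewrite /F/= in_itv/= u1 andbT.
  rewrite -[leRHS]invrK lef_pV2 ?posrE ?invr_gt0// ltW//.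
  by apply: (lt_le_trans (truncnS_gt _)); rewrite ler_nat.
apply: (@le_lt_trans _ _ (a^-1)%:E); last exact: ltry.
have cF : (\int[mu]_(u in F n) (u `^ (a - 1))%:E)%E @[n --> \oo] -->
          (\int[mu]_(u in \bigcup_n F n) (u `^ (a - 1))%:E)%E.
  apply: ge0_nondecreasing_set_cvg_integral => //.
  - move=> m n mn; apply/subsetPset => u; rewrite /F /= !in_itv/= => /andP[mu ->].
    by rewrite andbT (le_trans _ mu)// lef_pV2 ?posrE// ler_nat.
  - by move=> n; exact: measurable_itv.
  - by move=> n; exact: mp.
  - by move=> n u _; rewrite lee_fin powR_ge0.
apply: cvge_le cF; apply: nearW => n.
have n01 : (n.+2%:R^-1 : R) < 1 by rewrite invf_lt1// ltr1n.
have n0 : 0 < (n.+2%:R^-1 : R) by [].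
rewrite /F (@continuous_FTC2 _ _ (fun u => a^-1 * u `^ a))//.
- by rewrite powR1 mulr1 -EFinB lee_fin gerBl mulr_ge0 ?powR_ge0// invr_ge0 ltW.
- apply: continuous_in_subspaceT => u; rewrite inE/= in_itv/= => /andP[nu _].
  by apply: continuous_powR_gt0; exact: lt_le_trans nu.
- have cu u : 0 < u -> {for u, continuous (fun u => a^-1 * u `^ a)}.
    by move=> u0; apply: cvgMr; exact: continuous_powR_gt0.
  split.
  + move=> u; rewrite in_itv/= => /andP[nu _].
    apply: derivableM => //; apply: derivable_powR.
    by rewrite in_itv/= (lt_trans _ nu).
  + by apply: cvg_at_right_filter; exact: cu.
  + by apply: cvg_at_left_filter; exact: cu.
- move=> u; rewrite in_itv/= => /andP[nu _].
  have u0 : 0 < u by exact: lt_trans nu.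
  have := is_derive1_powR a u0.
  move=> du; rewrite derive1E derive_val.
  by rewrite /GRing.scale/= mulrA mulVf ?mul1r// gt_eqF.
Qed.

Lemma measurable_powR_expR a b (D : set R) :
  measurable_fun D (fun u => u `^ (a - 1) * expR (- (b * u))).
Proof.
apply/measurable_funTS/measurable_funM; first exact: measurable_powR.
apply: measurableT_comp => //.
by apply: measurableT_comp => //; exact: measurable_funM.
Qed.

Lemma integrable_powR_expR01 a b : 0 < a -> 0 <= b ->
  mu.-integrable `]0, 1] (EFin \o (fun u => u `^ (a - 1) * expR (- (b * u)))).
Proof.
move=> a0 b0; apply: le_integrable (integrable_powR01 a0) => //.
  by apply/measurable_EFinP; exact: measurable_powR_expR.
move=> u /=; rewrite in_itv/= => /andP[u0 _]; rewrite lee_fin normrM.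
rewrite [X in _ * X]ger0_norm ?expR_ge0// ler_piMr// expR_le1 oppr_le0.
by rewrite mulr_ge0// ltW.
Qed.

(** Near 0 the power dominates. On []1, +oo[] the integrand is at most a multiple of the exponential
    density of rate 1/2. *)
Lemma integrable_Gamma a : 0 < a ->
  mu.-integrable `]0, +oo[ (EFin \o (fun u => u `^ (a - 1) * expR (- u))).
Proof.
move=> a0.
have mf D : measurable_fun D (fun u : R => u `^ (a - 1) * expR (- u)).
  apply/measurable_funTS/measurable_funM; first exact: measurable_powR.
  by apply: measurableT_comp => //; exact: measurableT_comp.
have -> : `]0, +oo[ = `]0, 1] `|` `]1, +oo[ :> set R.
  by rewrite -itv_bndbnd_setU// bnd_simp.
apply: integrable_disjU => //.
  apply/disj_setPS => u []; rewrite /= !in_itv/= andbT => /andP[_ u1].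
  by rewrite ltNge u1.
  apply: eq_integrable (integrable_powR_expR01 a0 ler01) => // u _ /=.
  by rewrite mul1r.
(* u^(a-1) <= u^B <= (2B)^B e^(u/2), the latter from y <= e^y at y = u/(2B) *)
pose B := `|a - 1| + 1; have B0 : 0 < B by rewrite ltr_wpDl.
pose K := 2 * (2 * B) `^ B.
pose r : R := 2^-1; have r0 : 0 < r by rewrite invr_gt0.
have iE : mu.-integrable `]1, +oo[ (fun u => K%:E * (exponential_pdf r u)%:E)%E.
  apply: integrableZl => //.
  by apply: integrableS (integrable_exponential_pdf r0) => //; exact: measurable_itv.
apply: le_integrable iE => //; first by apply/measurable_EFinP; exact: mf.
move=> u /=; rewrite in_itv/= andbT => u1; rewrite lee_fin.
have u0 : 0 <= u by rewrite (le_trans ler01)// ltW.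
rewrite ger0_norm ?mulr_ge0 ?powR_ge0 ?expR_ge0//.
rewrite ger0_norm; last first.
  by rewrite mulr_ge0 ?exponential_pdf_ge0// ?mulr_ge0 ?powR_ge0// ltW.
rewrite exponential_pdfE//.
have -> : K * (r * expR (- r * u)) = (2 * B) `^ B * expR (u / 2) * expR (- u).
  rewrite -mulrA -expRD /K /r mulrACA divff// mul1r; congr (_ * expR _).
  by field.
rewrite ler_wpM2r ?expR_ge0//.
apply: (@le_trans _ _ (u `^ B)).
  by rewrite ler_powR ?(ltW u1)// /B (le_trans (ler_norm _))// lerDl.
have -> : u = (2 * B) * (u / (2 * B)) by field; rewrite gt_eqF.
rewrite powRM ?mulr_ge0 ?invr_ge0 ?mulr_ge0 ?(ltW B0)//.
rewrite ler_wpM2l ?powR_ge0//.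
set y := u / (2 * B).
have -> : 2 * B * y / 2 = y * B by field.
rewrite expRM ge0_ler_powR ?nnegrE ?expR_ge0 ?(ltW B0)//.
- by rewrite /y mulr_ge0 ?invr_ge0 ?mulr_ge0 ?(ltW B0).
- by apply: le_trans (expR_ge1Dx _); rewrite lerDr.
Qed.

(** If the integral were 0, [f] would vanish almost everywhere on [D]; as [f] is positive there, [D]
    would be null. *)
Lemma Rintegral_gt0 (D : set R) (f : R -> R) : measurable D ->
  mu.-integrable D (EFin \o f) -> (forall u, D u -> 0 < f u) -> mu D != 0%E ->
  0 < \int[mu]_(u in D) f u.
Proof.
move=> mD fi f0 D0.
rewrite lt_neqAle Rintegral_ge0 ?andbT; last by move=> u /f0/ltW.
apply: contra D0 => /eqP I0; apply/eqP.
have mf := measurable_int mu fi.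
have /(ae_eq_integral_abs mu mD mf) : (\int[mu]_(u in D) `|(EFin \o f) u| = 0)%E.
  have <- : (\int[mu]_(u in D) (f u)%:E = \int[mu]_(u in D) `|(EFin \o f) u|)%E.
    by apply: eq_integral => u /[!inE] /f0/ltW h; rewrite /= ger0_norm.
  rewrite -[LHS]fineK ?integrable_fin_num//.
  by rewrite -/(Rintegral mu D f) -I0.
move=> [N [mN N0 DN]]; apply/eqP; rewrite -measure_le0 -N0.
apply: le_measure; rewrite ?inE// => u Du; apply: DN => /= h.
by have [] := h Du; apply/eqP; rewrite gt_eqF ?f0.
Qed.

Lemma Gamma_gt0 a : 0 < a -> 0 < Gamma a.
Proof.
move=> a0; apply: Rintegral_gt0 => //; first exact: integrable_Gamma.
  move=> u /=; rewrite in_itv/= andbT => u0.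
  by rewrite mulr_gt0 ?powR_gt0 ?expR_gt0.
by rewrite lebesgue_measure_itv/= ltry.
Qed.

(** Lebesgue measure is [b^-1] times its pushforward under [x -> x / b]: the two agree on half-open
    intervals, hence everywhere by uniqueness. The formula is then integration against a
    pushforward. *)
Lemma ge0_integral_rescale b (D : set R) (f : R -> \bar R) :
  0 < b -> measurable D -> measurable_fun D f ->
  (forall u, D u -> 0 <= f u)%E ->
  (\int[mu]_(u in D) f u =
   (b^-1)%:E * \int[mu]_(x in [set x | D (b^-1 * x)%R]) f (b^-1 * x)%R)%E.
Proof.
move=> b0 mD mf f0.
have bV0 : 0 <= b^-1 by rewrite invr_ge0 ltW.
pose phi : R -> measurableTypeR R := fun x => b^-1 * x.
have mphi : measurable_fun [set: R] phi by exact: measurable_funM.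
have bbV : b^-1 * b = 1 by rewrite mulVf// gt_eqF.
have mu_nu X : measurable X -> mu X = ((b^-1)%:E * pushforward mu phi X)%E.
  move: X; apply: (@lebesgue_measure_unique R
    (mscale (NngNum bV0) (pushforward mu phi))).
  move=> X [[p q] _ <-] /=.
  change (mu `]p, q] = (b^-1)%:E * mu (phi @^-1` `]p, q]))%E.
  have -> : phi @^-1` `]p, q] = `]b * p, b * q].
    by apply/seteqP; split => u; rewrite /= !in_itv/= /phi ltr_pdivlMl// ler_pdivrMl.
  rewrite !lebesgue_measure_itv/= !lte_fin ltr_pM2l//.
  case: ifP => _; last by rewrite mule0.
  by rewrite -!EFinB -EFinM -mulrBr mulrA bbV mul1r.
rewrite (eq_measure_integral (mscale (NngNum bV0) (pushforward mu phi))); last first.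
  by move=> X mX _; exact: (mu_nu X mX).
rewrite ge0_integral_mscale//= ge0_integral_pushforward//.
by move=> u /[!inE] /f0.
Qed.

Lemma Rintegral_rescale b (D : set R) (f : R -> R) :
  0 < b -> measurable D -> measurable_fun D f -> (forall u, D u -> 0 <= f u) ->
  \int[mu]_(u in D) f u =
  b^-1 * \int[mu]_(x in [set x | D (b^-1 * x)]) f (b^-1 * x).
Proof.
move=> b0 mD mf f0; have bV0 : 0 < b^-1 by rewrite invr_gt0.
rewrite {1}/Rintegral (ge0_integral_rescale b0)//; last exact/measurable_EFinP.
(* Infinite values are sent to 0 by [fine] on both sides, so integrability need not be assumed. *)
rewrite /Rintegral; case: (integral _ _ _) => [r//| |].
  by rewrite gt0_muley ?lte_fin//= mulr0.
by rewrite gt0_muleNy ?lte_fin//= mulr0.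
Qed.

(** The normalization of [gamma_reg] cancels, and the substitution [y = x * u] moves the dependence
    on [x] from the domain into the integrand. *)
Lemma Gamma_gamma_reg a x : 0 < a -> 0 < x ->
  Gamma a * gamma_reg a x =
  x `^ a * \int[mu]_(u in `]0, 1]) (u `^ (a - 1) * expR (- (x * u))).
Proof.
move=> a0 x0; rewrite /gamma_reg mulrC divfK ?gt_eqF ?Gamma_gt0//.
rewrite Rintegral_itv_bndo_bndc; last first.
  apply: integrableS (integrable_Gamma a0) => //.
  by move=> u /=; rewrite !in_itv/= => /andP[->].
pose f u := u `^ (a - 1) * expR (- (x * u)).
have f0 u : `]0, 1] u -> 0 <= f u.
  by move=> _; rewrite mulr_ge0 ?powR_ge0 ?expR_ge0.
have mf : measurable_fun (`]0, 1] : set R) f by exact: measurable_powR_expR.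
rewrite (Rintegral_rescale x0 (measurable_itv _) mf f0) /f {f f0 mf}.
have -> : [set y | (`]0, 1] : set R) (x^-1 * y)] = `]0, x].
  apply/seteqP; split => y; rewrite /= !in_itv/= ler_pdivrMl// mulr1;
    by rewrite pmulr_rgt0 ?invr_gt0.
have iG : mu.-integrable `]0, x] (EFin \o (fun y => y `^ (a - 1) * expR (- y))).
  apply: integrableS (integrable_Gamma a0) => //.
  by move=> u /=; rewrite !in_itv/= => /andP[->].
(* The inserted powers multiply to 1; [x^(1-a)] is what [(y / x)^(a-1)] releases. *)
rewrite mulrA [RHS](_ : _ = x `^ a / x * (x `^ (1 - a) *
    \int[mu]_(y in `]0, x]) (y `^ (a - 1) * expR (- y)))).
  rewrite mulrA -[X in _ / X * _]powRr1 ?ltW// -powRN -!powRD ?(gt_eqF x0) ?implybT//.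
  by rewrite (_ : a + - 1 + (1 - a) = 0) ?powRr0 ?mul1r//; ring.
congr *%R; rewrite -RintegralZl//.
apply: eq_Rintegral => y; rewrite inE/= in_itv/= => /andP[y0 _].
rewrite powRM ?invr_ge0 ?ltW// mulrA -(powR_inv1 (ltW x0)) -powRrM.
rewrite mulrA powR_inv1 ?ltW// mulfV ?gt_eqF// mul1r; congr (_ `^ _ * _ * _).
ring.
Qed.

End incomplete_gamma.

(** * Mixtures of the sub-exponential kernel *)

Section mixture.
Context {R : realType}.
Notation mu := (@lebesgue_measure R).
Implicit Types c s v u : R.

(* With lambda = (1 - u) / c, the range 0 <= lambda < 1/c becomes 0 < u <= 1. *)
Definition sub_exp_kernel c s v u : R :=
  expR ((1 - u) / c * s - psi_E c ((1 - u) / c) * v).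

(** Since [1 - c * lambda = u], the exponent is linear in [s / c] and [v / c^2], with the explicit
    coefficients [1 - u] and [ln u + 1 - u]. *)
Lemma sub_exp_kernelE c s v u : c != 0 ->
  sub_exp_kernel c s v u =
  expR ((1 - u) * (s / c) + (ln u + (1 - u)) * (v / c ^+ 2)).
Proof.
move=> c0; rewrite /sub_exp_kernel /psi_E.
have -> : c * ((1 - u) / c) = 1 - u by field.
rewrite subKr; congr expR; by field.
Qed.

Lemma ln_le_subr1 u : 0 < u -> ln u <= u - 1.
Proof.
by move=> u0; have := expR_ge1Dx (ln u); rewrite lnK ?posrE//; lra.
Qed.

Lemma measurable_sub_exp_kernel c s v D : c != 0 ->
  measurable_fun D (sub_exp_kernel c s v).
Proof.
move=> c0; apply: measurable_funTS.
rewrite (funext (fun u => sub_exp_kernelE s v u c0)).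
have m1 : measurable_fun [set: R] (fun u : R => 1 - u) by exact: measurable_funB.
apply: measurableT_comp => //; apply: measurable_funD.
  exact: measurable_funM.
apply: measurable_funM => //.
by apply: measurable_funD => //; exact: measurable_ln.
Qed.

(** The coefficient [ln u + 1 - u] of [v / c^2] is nonpositive. *)
Lemma sub_exp_kernel_ge_v c s v v' u : 0 < c -> 0 < u -> v <= v' ->
  sub_exp_kernel c s v' u <= sub_exp_kernel c s v u.
Proof.
move=> c0 u0 vv; rewrite !sub_exp_kernelE ?gt_eqF// ler_expR lerD2l.
rewrite ler_wnM2l//; first by have := ln_le_subr1 u0; lra.
by rewrite ler_pM2r// invr_gt0 exprn_gt0.
Qed.

Lemma sub_exp_kernelDs c s t v u :
  sub_exp_kernel c (s + t) v u = expR ((1 - u) * (t / c)) * sub_exp_kernel c s v u.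
Proof. by rewrite /sub_exp_kernel -expRD; congr expR; ring. Qed.

(** Moving [u] right to [u'] lowers [1 - u] by at most [h], while [ln] only increases; so the
    exponent loses at most [(s / c + v / c^2) * h]. *)
Lemma sub_exp_kernel_mesh c s v u u' h : 0 < c -> 0 <= s -> 0 <= v ->
  0 < u -> u <= u' -> u' - u <= h ->
  sub_exp_kernel c s v u <=
  expR ((s / c + v / c ^+ 2) * h) * sub_exp_kernel c s v u'.
Proof.
move=> c0 s0 v0 u0 uu h0; rewrite !sub_exp_kernelE ?gt_eqF// -expRD ler_expR.
have sc : 0 <= s / c by rewrite divr_ge0// ltW.
have vc : 0 <= v / c ^+ 2 by rewrite divr_ge0// sqr_ge0.
have lnu : ln u <= ln u' by rewrite ler_ln ?posrE// (lt_le_trans u0).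
move: (s / c) (v / c ^+ 2) sc vc => x y x0 y0.
have : 0 <= (x + y) * (h - (u' - u)) by rewrite mulr_ge0 ?subr_ge0 ?addr_ge0.
have : 0 <= y * (ln u' - ln u) by rewrite mulr_ge0// subr_ge0.
lra.
Qed.

Context (c : R) (w : R -> R).
Hypotheses (c0 : 0 < c) (w0 : forall u, 0 < u <= 1 -> 0 < w u).
Hypothesis iw : mu.-integrable `]0, 1] (EFin \o w).

Definition mixture s v : R :=
  \int[mu]_(u in `]0, 1]) (sub_exp_kernel c s v u * w u).

(** The kernel is bounded by [e^(s/c)]: replace [v] by 0, then use [1 - u <= 1]. *)
Lemma integrable_mixture s v : 0 <= s -> 0 <= v ->
  mu.-integrable `]0, 1] (EFin \o (fun u => sub_exp_kernel c s v u * w u)).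
Proof.
move=> s0 v0.
have iE : mu.-integrable `]0, 1] (fun u => (expR (s / c))%:E * (w u)%:E)%E.
  exact: integrableZl.
apply: le_integrable iE => //.
  apply/measurable_EFinP/measurable_funM.
    by apply: measurable_sub_exp_kernel; rewrite gt_eqF.
  by apply/measurable_EFinP; exact: (measurable_int mu iw).
move=> u; rewrite /= in_itv/= => /andP[u0 u1]; rewrite lee_fin.
rewrite !normrM ler_wpM2r// !ger0_norm ?expR_ge0//.
apply: le_trans (sub_exp_kernel_ge_v _ c0 u0 v0) _ => //.
rewrite sub_exp_kernelE ?gt_eqF// ler_expR mul0r mulr0 addr0 ler_piMl//.
  by rewrite divr_ge0// ltW.
by rewrite gerBl ltW.
Qed.

Lemma mixture_ge_v s v v' : 0 <= s -> 0 <= v -> v <= v' ->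
  mixture s v' <= mixture s v.
Proof.
move=> s0 v0 vv; apply: le_Rintegral => //.
- by apply: integrable_mixture => //; exact: le_trans vv.
- exact: integrable_mixture.
- move=> u; rewrite /= in_itv/= => /andP[u0 u1].
  by rewrite ler_pM2r ?sub_exp_kernel_ge_v// w0 ?u0.
Qed.

(** A quantitative form of right continuity in [s], from [(1 - u) * t / c <= t / c]. *)
Lemma mixtureDs_le s t v : 0 <= s -> 0 <= t -> 0 <= v ->
  mixture (s + t) v <= expR (t / c) * mixture s v.
Proof.
move=> s0 t0 v0; have iE := integrable_mixture s0 v0.
rewrite -RintegralZl//; apply: le_Rintegral => //.
- by apply: integrable_mixture; rewrite ?addr_ge0.
- exact: integrable_EFinZl.
- move=> u; rewrite /= in_itv/= => /andP[u0 u1].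
  rewrite mulrA ler_pM2r ?w0 ?u0// sub_exp_kernelDs ler_wpM2r ?expR_ge0//.
  by rewrite ler_expR ler_piMl ?divr_ge0 ?(ltW c0)// gerBl ltW.
Qed.

(** Only the mass on [u <= 1/2] is kept; there [1 - u >= 1/2], so the kernel grows at least like
    [e^(s/(2c))]. *)
Lemma mixture_unbounded v : 0 <= v -> exists2 k, 0 < k &
  forall s, 0 <= s -> expR (s / (2 * c)) * k <= mixture s v.
Proof.
move=> v0; have sub : `]0, 2^-1] `<=` `]0, (1 : R)].
  move=> u /=; rewrite !in_itv/= => /andP[-> u1] /=.
  by apply: le_trans u1 _; lra.
have ib s : 0 <= s -> mu.-integrable `]0, 2^-1]
    (EFin \o (fun u => sub_exp_kernel c s v u * w u)).
  move=> s0; apply: integrableS (integrable_mixture s0 v0) => //.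
exists (\int[mu]_(u in `]0, 2^-1]) (sub_exp_kernel c 0 v u * w u)).
  apply: Rintegral_gt0 => //; first exact: ib.
    move=> u /sub /=; rewrite in_itv/= => u01.
    by rewrite mulr_gt0 ?expR_gt0// w0.
  rewrite lebesgue_measure_itv/= lte_fin invr_gt0 ltr0n/= oppr0 adde0.
  by rewrite eqe invr_eq0 pnatr_eq0.
move=> s s0; apply: (@le_trans _ _
    (\int[mu]_(u in `]0, 2^-1]) (sub_exp_kernel c s v u * w u))).
  have i0 := ib 0 (lexx 0).
  rewrite -RintegralZl//; apply: le_Rintegral => //.
  - exact: integrable_EFinZl.
  - exact: ib.
  - move=> u Du; have /= := sub _ Du; rewrite in_itv/= => u01.
    move: Du; rewrite /= in_itv/= => /andP[u0 u2].
    rewrite mulrA ler_pM2r ?w0// -[in leRHS](add0r s) sub_exp_kernelDs.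
    rewrite ler_wpM2r ?expR_ge0// ler_expR invfM mulrA [s / 2]mulrC -mulrA.
    by rewrite ler_wpM2r ?divr_ge0 ?(ltW c0)//; lra.
rewrite /Rintegral fine_le//.
- by apply: integrable_fin_num => //; exact: ib.
- by apply: integrable_fin_num => //; exact: integrable_mixture.
apply: ge0_subset_integral => //.
- exact: (measurable_int mu (integrable_mixture s0 v0)).
- move=> u; rewrite /= in_itv/= => u01.
  by rewrite lee_fin mulr_ge0 ?expR_ge0// ltW// w0.
Qed.

End mixture.

(** * Discretization of the mixture on a mesh *)

Section partition.
Context {R : realType}.
Notation mu := (@lebesgue_measure R).

Lemma Rintegral_itv_sum (t : nat -> R) (h : R -> R) m :
  {homo t : i j / (i <= j)%N >-> i <= j} ->
  mu.-integrable `]t 0%N, t m] (EFin \o h) ->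
  \int[mu]_(u in `]t 0%N, t m]) h u =
    \sum_(k < m) \int[mu]_(u in `]t k, t k.+1]) h u.
Proof.
move=> tle; elim: m => [_|m IH ih].
  by rewrite big_ord0 set_itvxx Rintegral_set0.
rewrite big_ord_recr/= -IH; last first.
  apply: integrableS ih => // u; rewrite /= !in_itv/= => /andP[->] um /=.
  by rewrite (le_trans um)// tle.
by rewrite -(Rintegral_itvB (x := t m) ih) ?bnd_simp ?tle// addrC subrK.
Qed.

Context (c : R) (w : R -> R).
Hypotheses (c0 : 0 < c) (w0 : forall u, 0 < u <= 1 -> 0 < w u).
Hypothesis iw : mu.-integrable `]0, 1] (EFin \o w).

(** Each cell of width [1/(n+1)] is compared with its right endpoint. That tag is never 0, so it
    corresponds to some [lambda < 1/c]. *)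
Lemma mixture_mesh n s v : 0 <= s -> 0 <= v ->
  mixture c w s v <= expR ((s / c + v / c ^+ 2) / n.+1%:R) *
    \sum_(k < n.+1) (\int[mu]_(u in `]k%:R / n.+1%:R, k.+1%:R / n.+1%:R]) w u)
                    * sub_exp_kernel c s v (k.+1%:R / n.+1%:R).
Proof.
move=> s0 v0; pose t (k : nat) : R := k%:R / n.+1%:R.
have nV0 : 0 < n.+1%:R^-1 :> R by rewrite invr_gt0.
have tle : {homo t : i j / (i <= j)%N >-> i <= j}.
  by move=> i j ij; rewrite /t ler_pM2r// ler_nat.
have t0 : t 0%N = 0 by rewrite /t mul0r.
have t1 : t n.+1 = 1 by rewrite /t divff.
have iK := integrable_mixture c0 iw s0 v0.
have -> : mixture c w s v =
    \int[mu]_(u in `]t 0%N, t n.+1]) (sub_exp_kernel c s v u * w u).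
  by rewrite t0 t1.
rewrite Rintegral_itv_sum//; last by rewrite t0 t1.
rewrite mulr_sumr; apply: ler_sum => -[k /= kn] _.
have sub : (`]t k, t k.+1] : set R) `<=` `]0, 1].
  move=> u; rewrite /= !in_itv/= -t0 -t1 => /andP[ku uk].
  by rewrite (le_lt_trans _ ku) ?(le_trans uk)// tle.
have iwk : mu.-integrable `]t k, t k.+1] (EFin \o w) by exact: integrableS iw.
have iKk : mu.-integrable `]t k, t k.+1]
    (EFin \o (fun u => sub_exp_kernel c s v u * w u)) by exact: integrableS iK.
rewrite [X in _ * X]mulrC mulrA -RintegralZl//; apply: le_Rintegral => //.
  exact: integrable_EFinZl.
move=> u Du; have /= := sub _ Du; rewrite in_itv/= => u01.
move: Du; rewrite /= in_itv/= => /andP[ku uk].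
rewrite ler_pM2r ?w0// sub_exp_kernel_mesh//; first by case/andP: u01.
by rewrite lerBlDr /t -natr1 mulrDl mul1r addrC lerD2l ltW.
Qed.

End partition.

(** * The boundary as supremum of a sublevel set *)

Section boundary.
Context {R : realType}.
Notation mu := (@lebesgue_measure R).
Context (c : R) (w : R -> R).
Hypotheses (c0 : 0 < c) (w0 : forall u, 0 < u <= 1 -> 0 < w u).
Hypothesis iw : mu.-integrable `]0, 1] (EFin \o w).

Definition mixture_sublevel (L v : R) : set R :=
  [set s | 0 <= s /\ mixture c w s v < L].

Lemma mixture_sublevel_ubound L v : 0 <= v ->
  has_ubound (mixture_sublevel L v).
Proof.
move=> v0; have [k k0 km] := mixture_unbounded c0 w0 iw v0.
exists (2 * c * (L / k)) => s [s0 sL].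
have c20 : 0 < 2 * c by rewrite mulr_gt0.
rewrite mulrC -ler_pdivrMr// ler_pdivlMr//.
apply: le_trans (ltW (le_lt_trans (km s s0) sL)).
rewrite ler_pM2r//; apply: le_trans (expR_ge1Dx _).
by rewrite lerDr.
Qed.

Lemma sup_mixture_sublevel_ge0 L v : 0 <= v -> 0 <= sup (mixture_sublevel L v).
Proof.
move=> v0; have [->|/set0P[s [s0 sL]]] := eqVneq (mixture_sublevel L v) set0.
  (* The supremum of the empty set is 0 by convention. *)
  by rewrite sup0.
by apply: (le_trans s0); apply: ub_le_sup => //; exact: mixture_sublevel_ubound.
Qed.

Lemma sup_mixture_sublevel_homo L v v' : 0 <= v -> v <= v' ->
  sup (mixture_sublevel L v) <= sup (mixture_sublevel L v').
Proof.
move=> v0 vv; have v'0 := le_trans v0 vv.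
have [->|/set0P ne] := eqVneq (mixture_sublevel L v) set0.
  by rewrite sup0 sup_mixture_sublevel_ge0.
apply: ge_sup => // s [s0 sL]; apply: ub_le_sup.
  exact: mixture_sublevel_ubound.
by split; [exact: s0|exact: le_lt_trans (mixture_ge_v c0 w0 iw s0 v0 vv) sL].
Qed.

(** If the mixture were below [L] at [s], its controlled growth would keep it below [L] slightly to
    the right of [s], contradicting the supremum. *)
Lemma le_mixture_sup L v s : 0 <= v -> sup (mixture_sublevel L v) <= s ->
  0 <= s /\ L <= mixture c w s v.
Proof.
move=> v0 sups; have s0 := le_trans (sup_mixture_sublevel_ge0 L v0) sups.
split => //; rewrite leNgt; apply/negP => sL.
have [k k0 km] := mixture_unbounded c0 w0 iw v0.
have m0 : 0 < mixture c w s v.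
  by apply: lt_le_trans (km s s0); rewrite mulr_gt0 ?expR_gt0.
set m := mixture c w s v in sL m0 *.
(* A step of [c * ln r] multiplies the mixture by at most [r], hence takes it at most to the
   midpoint of [m] and [L]. *)
pose r := (m + L) / 2 / m.
have rm : r * m = (m + L) / 2 by rewrite /r divfK// gt_eqF.
have r1 : 1 < r by rewrite ltr_pdivlMr//; lra.
have r0 : 0 < r by exact: lt_trans r1.
have lnr : 0 < ln r by rewrite ln_gt0.
have : s + c * ln r <= s.
  apply: le_trans sups; apply: ub_le_sup; first exact: mixture_sublevel_ubound.
  split; first by rewrite addr_ge0// mulr_ge0// ltW.
  apply: le_lt_trans (mixtureDs_le c0 w0 iw s0 _ v0) _.
    by rewrite mulr_ge0// ltW.
  rewrite [c * _]mulrC mulfK ?gt_eqF// lnK ?posrE// -/m rm; lra.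
by rewrite gerDl leNgt mulr_gt0.
Qed.

End boundary.

(** * Ville's inequality for supermartingale mixtures *)

Section ville.
Context {d : measure_display} {T : measurableType d} {R : realType}.
Context (P : probability T R).

(** Gives access to the closure properties of [measurable_fun] for a sub-sigma-algebra. *)
Lemma measurable_wrtE (G : set_system T) (X : T -> R) :
  sigma_algebra setT G ->
  measurable_wrt G X <->
  measurable_fun setT (X : g_sigma_algebraType G -> R).
Proof.
move=> sG; have GE : @measurable _ (g_sigma_algebraType G) = G.
  exact: sigma_algebra_id.
split.
  by move=> mX _ B mB; rewrite GE; apply: mX; exists B.
by move=> mX _ [B mB <-]; rewrite -GE; exact: mX.
Qed.

Lemma measurable_wrt_sub (G : set_system T) (X : T -> R) :
  G `<=` measurable -> measurable_wrt G X -> measurable_fun setT X.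
Proof. by move=> GT mX _ B mB; apply/GT/mX; exists B. Qed.

(* The supermartingale inequality integrated over the events of F t; unlike
   [supermartingale] it is visibly linear in L. *)
Definition isupermartingale (F : nat -> set_system T) (L : nat -> T -> R) :=
  [/\ adapted F L, forall t, P.-integrable setT (EFin \o L t)
    & forall t A, F t A ->
        \int[P]_(w in A) L t.+1 w <= \int[P]_(w in A) L t w].

Lemma integrable_sub (A : set T) (X : T -> R) :
  measurable A -> P.-integrable setT (EFin \o X) ->
  P.-integrable A (EFin \o X).
Proof. by move=> mA; apply: integrableS. Qed.

Lemma supermartingale_isupermartingale (F : nat -> set_system T)
    (L : nat -> T -> R) :
  filtration F -> supermartingale P F L -> isupermartingale F L.
Proof.
move=> [sF FT _] [aL iL cL]; split => // t A FA.
have mA : measurable A by exact: FT FA.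
have [Y [mY iY eY] YL] := cL t.
rewrite [leLHS]/Rintegral -eY// -/(Rintegral P A Y).
(* [Z] agrees with [Y] almost surely and lies below [L t] everywhere, so monotonicity of the
   integral applies pointwise. *)
pose Z := fun w => Num.min (Y w) (L t w).
have mYT : measurable_fun setT Y by apply: measurable_wrt_sub mY; exact: FT.
have mLT : measurable_fun setT (L t) by apply: measurable_wrt_sub (aL t); exact: FT.
have mZ : measurable_fun setT Z by exact: measurable_minr.
have YZ : (\int[P]_(w in A) (Y w)%:E = \int[P]_(w in A) (Z w)%:E)%E.
  apply: ae_eq_integral => //.
  - by apply/measurable_EFinP; exact: measurable_funTS.
  - by apply/measurable_EFinP; exact: measurable_funTS.
  - apply: filterS YL => w YLw _.
    by rewrite /Z min_l.
have iZ : P.-integrable setT (EFin \o Z).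
  apply: (@le_integrable _ _ _ P _ _ _
    (EFin \o (fun w => `|Y w| + `|L t w|))) => //.
  - exact/measurable_EFinP.
  - move=> w _; rewrite /= lee_fin [leRHS]ger0_norm ?addr_ge0// /Z.
    by rewrite /Num.min; case: ifP => _; rewrite ?lerDl ?lerDr.
  - apply: (integrableD _ (integrable_abse iY) (integrable_abse (iL t))).
    exact: measurableT.
rewrite /Rintegral YZ; apply: le_Rintegral => //; try exact: integrable_sub.
by move=> w _; rewrite /Z ge_min lexx orbT.
Qed.

Lemma isupermartingale0 (F : nat -> set_system T) :
  filtration F -> isupermartingale F (fun _ _ => 0).
Proof.
move=> [sF FT _]; split=> //.
- by move=> t; apply/measurable_wrtE => //; exact: measurable_cst.
- by move=> t; exact: (integrable0 P).
Qed.

Lemma isupermartingaleD (F : nat -> set_system T) (a : R)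
    (L M : nat -> T -> R) : filtration F -> 0 <= a ->
  isupermartingale F L -> isupermartingale F M ->
  isupermartingale F (fun t w => a * L t w + M t w).
Proof.
move=> [sF FT _] a0 [aL iL dL] [aM iM dM].
have iaL t : P.-integrable setT (EFin \o (fun w => a * L t w)).
  exact: (integrableZl measurableT a (iL t)).
split.
- move=> t; apply/measurable_wrtE => //.
  apply: measurable_funD; last exact/measurable_wrtE.
  by apply: measurable_funM => //; exact/measurable_wrtE.
- by move=> t; exact: (integrableD measurableT (iaL t) (iM t)).
- move=> t A FA; have mA : measurable A by exact: FT FA.
  have IE s : \int[P]_(w in A) (a * L s w + M s w) =
      a * \int[P]_(w in A) L s w + \int[P]_(w in A) M s w.
    rewrite RintegralD//; [|exact: integrable_sub|exact: integrable_sub].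
    by rewrite RintegralZl//; exact: integrable_sub.
  by rewrite !IE lerD ?dM// ler_wpM2l ?dL.
Qed.

(** Both claims share one induction, since splitting the integral uses integrability of the partial
    sum. *)
Lemma isupermartingale_sum (F : nat -> set_system T) (n : nat) (a : nat -> R)
    (L : nat -> nat -> T -> R) : filtration F -> (forall k, (k < n)%N -> 0 <= a k) ->
  (forall k, (k < n)%N -> isupermartingale F (L k)) ->
  isupermartingale F (fun t w => \sum_(k < n) a k * L k t w) /\
  \int[P]_w (\sum_(k < n) a k * L k 0%N w) =
    \sum_(k < n) a k * \int[P]_w L k 0%N w.
Proof.
move=> fF; elim: n => [_ _|n IH a0 sL].
  split.
    under eq_fun do under eq_fun do rewrite big_ord0.
    exact: isupermartingale0.
  under eq_Rintegral do rewrite big_ord0.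
  by rewrite big_ord0 /Rintegral integral0.
have [||sM eM] := IH; [by move=> k kn; exact/a0/ltnW|by move=> k kn; exact/sL/ltnW|].
have sn := sL n (ltnSn n); split.
  under eq_fun do under eq_fun do rewrite big_ord_recr/= addrC.
  by apply: isupermartingaleD => //; exact: a0.
under eq_Rintegral do rewrite big_ord_recr/=.
have [_ iM _] := sM; have [_ iL _] := sn.
rewrite RintegralD//; last exact: (integrableZl measurableT (a n) (iL 0%N)).
by rewrite eM big_ord_recr/= RintegralZl.
Qed.

(** No stopping time is introduced: [C t] records a crossing of [a] by time [t], a bound on its
    probability is proved by induction on [t], and continuity from below gives the limit. *)
Lemma ville (F : nat -> set_system T) (M : nat -> T -> R) (a : R) :
  filtration F -> isupermartingale F M ->
  (forall t, {ae P, forall w, 0 <= M t w}) -> 0 < a ->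
  ((a%:E * P [set w | exists t, (a <= M t w)%R]) <= (\int[P]_w M 0%N w)%:E)%E.
Proof.
move=> [sF FT Fmono] [aM iM dM] M0 a0.
pose C t := [set w | exists2 s, (s <= t)%N & a <= M s w].
have mM s t : (s <= t)%N ->
    measurable_fun setT (M s : g_sigma_algebraType (F t) -> R).
  move=> st; apply/measurable_wrtE => //.
  by apply: subset_trans (aM s) _; exact: Fmono.
have FC t : F t (C t).
  have -> : C t = \bigcup_(s in [set s | (s <= t)%N])
      (M s @^-1` `[a, +oo[).
    apply/seteqP; split => w /=.
      by move=> [s st h]; exists s => //=; rewrite in_itv/= h.
    by move=> [s st /=]; rewrite in_itv/= andbT => h; exists s.
  rewrite -(sigma_algebra_id (sF t)).
  apply: (@bigcup_measurable _ (g_sigma_algebraType (F t))) => s st.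
  by rewrite -[X in measurable X]setTI; exact: mM.
have mC t : measurable (C t) by exact: FT (FC t).
have FB t : F t (~` C t).
  by rewrite -setTD; have [_ + _] := sF t; apply.
have PCE t : P (C t) = (fine (P (C t)))%:E by rewrite fineK// fin_num_measure.
(* This plays the role of the expectation of the stopped process. In the step, the supermartingale
   property is used on the complement of [C t], and the paths that first cross at [t.+1] contribute
   at least [a] times their probability. *)
have key t : a * fine (P (C t)) + \int[P]_(w in ~` C t) M t w
    <= \int[P]_w M 0%N w.
  have markov s (A : set T) : measurable A -> (forall w, A w -> a <= M s w) ->
      a * fine (P A) <= \int[P]_(w in A) M s w.
    move=> mA aA; rewrite -(Rintegral_cst P mA); apply: le_Rintegral => //.
      apply: integrable_sub => //.
      exact: finite_measure_integrable_cst.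
    exact: integrable_sub.
  elim: t => [|t IH].
    rewrite -(setUv (C 0%N)) Rintegral_setU//; last 3 first.
    - exact: measurableC.
    - by rewrite setUv.
    - exact/disj_setPCl.
    rewrite lerD2r; apply: markov => // w [s]; by rewrite leqn0 => /eqP ->.
  apply: le_trans IH.
  pose A := C t.+1 `\` C t.
  have mA : measurable A by exact: measurableD.
  have CS : C t `<=` C t.+1 by move=> w [s st h]; exists s => //; exact: leqW.
  have CE : C t.+1 = C t `|` A by rewrite /A setDUK.
  have BE : ~` C t = ~` C t.+1 `|` A.
    apply/seteqP; split => w /= => [nC|[nC /CS//|[]//]].
    by have [] := pselect (C t.+1 w); [right|left].
  have := dM t _ (FB t); rewrite {1}BE Rintegral_setU//; first last.
  - by apply/disj_setPS => w [nC [/nC]].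
  - by apply: integrable_sub => //; apply: measurableU => //; exact: measurableC.
  - exact: measurableC.
  have PC : fine (P (C t.+1)) = fine (P (C t)) + fine (P A).
    rewrite CE measureU ?fineD ?fin_num_measure//.
    by apply/seteqP; split => // w [] ? [].
  have := @markov t.+1 A mA _.
  rewrite PC mulrDr => h1 h2.
  have {}h1 : a * fine (P A) <= \int[P]_(w in A) M t.+1 w.
    apply: h1 => w [[s]]; rewrite leq_eqVlt => /predU1P[->//|st] h nC.
    by exfalso; apply: nC; exists s.
  lra.
have key2 t : a * fine (P (C t)) <= \int[P]_w M 0%N w.
  apply: le_trans (key t); rewrite lerDl.
  have mB : measurable (~` C t) by exact: measurableC.
  rewrite fine_ge0// -(integral0 P (~` C t)).
  (* [M t] is nonnegative only almost surely; its positive part is so everywhere and has the same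
     integral. *)
  pose Z w := Num.max 0 (M t w).
  have mMT : measurable_fun setT (M t).
    by apply: measurable_wrt_sub (aM t); exact: FT.
  rewrite [leRHS](@ae_eq_integral _ _ _ P _ (EFin \o Z))//.
  - by rewrite integral0; apply: integral_ge0 => w _; rewrite lee_fin le_max lexx.
  - by apply/measurable_EFinP; exact: measurable_funTS.
  - apply/measurable_EFinP/measurable_funTS.
    by apply: measurable_maxr => //; exact: measurable_cst.
  - apply: filterS (M0 t) => w Mw _.
    by rewrite /= /Z max_r.
have -> : [set w | exists t, a <= M t w] = \bigcup_t C t.
  apply/seteqP; split => w /=.
    by move=> [t h]; exists t => //; exists t.
  by move=> [t _ [s _ h]]; exists s.
have cvgC : P (C t) @[t --> \oo] --> P (\bigcup_t C t).
  apply: nondecreasing_cvg_mu => //; first exact: bigcup_measurable.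
  by move=> m n mn; apply/subsetPset => w [s sm h]; exists s => //; exact: leq_trans mn.
have {}cvgC := cvgeZl (erefl : a%:E \is a fin_num) cvgC.
apply: cvge_le cvgC.
apply: nearW => t; rewrite PCE -EFinM lee_fin; exact: key2.
Qed.

End ville.

(** * Crossing bound for the mixture process *)

Section mixture_ville.
Context {d : measure_display} {T : measurableType d} {R : realType}.
Context (P : probability T R).
Notation mu := (@lebesgue_measure R).

Lemma ae_le_measure (E G : set T) : measurable E -> measurable G ->
  {ae P, forall w, E w -> G w} -> (P E <= P G)%E.
Proof.
move=> mE mG [N [mN N0 EGN]].
have -> : P G = P (G `|` N) by rewrite measureU0.
apply: le_measure; rewrite ?inE//; first exact: measurableU.
move=> w Ew; have [Gw|nGw] := pselect (G w); [by left|right].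
by apply: EGN => /= h; apply/nGw/h.
Qed.

Context (c l0 : R) (w : R -> R) (F : nat -> set_system T) (S V : nat -> T -> R).
Hypotheses (c0 : 0 < c) (w0 : forall u, 0 < u <= 1 -> 0 < w u).
Hypothesis iw : mu.-integrable `]0, 1] (EFin \o w).
Hypothesis w1 : \int[mu]_(u in `]0, 1]) w u = 1.
Hypothesis SV : sub_psi P (psi_E c) (c^-1)%:E l0 F S V.

Lemma mixture_bounded_crossing (a B : R) (E : set T) : 0 < a -> 0 <= B ->
  measurable E ->
  (forall x, E x -> exists t, [/\ 0 <= S t x,
     S t x / c + V t x / c ^+ 2 <= B & a <= mixture c w (S t x) (V t x)]) ->
  a * fine (P E) <= l0.
Proof.
move=> a0 B0 mE Ecross; have [fF _ _ V0 SVL] := SV.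
have PE0 : 0 <= a * fine (P E) by rewrite mulr_ge0 ?fine_ge0// ltW.
(* The bound [B] makes the discretization loss [e^(-B/(n+1))] uniform on [E]; it is weakened to
   [1 - B/(n+1)], which makes the limit elementary. *)
have mesh n : (1 - B / n.+1%:R) * (a * fine (P E)) <= l0.
  pose t (k : nat) : R := k%:R / n.+1%:R.
  pose W (k : nat) := \int[mu]_(u in `]t k, t k.+1]) w u.
  have nV0 : 0 < n.+1%:R^-1 :> R by rewrite invr_gt0.
  have tle : {homo t : i j / (i <= j)%N >-> i <= j}.
    by move=> i j ij; rewrite /t ler_pM2r// ler_nat.
  have t0 : t 0%N = 0 by rewrite /t mul0r.
  have t1 : t n.+1 = 1 by rewrite /t divff.
  have W0 k : (k < n.+1)%N -> 0 <= W k.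
    move=> kn; apply: Rintegral_ge0 => u; rewrite /= in_itv/= => /andP[ku uk].
    apply/ltW/w0; rewrite -{1}t0 -t1 (le_lt_trans _ ku) ?(le_trans uk)//.
      exact: tle.
    exact: tle.
  have W1 : \sum_(k < n.+1) W k = 1.
    by rewrite -w1 -t1 -[in RHS]t0 Rintegral_itv_sum// t0 t1.
  (* One dominating supermartingale is chosen per tag; indices beyond the mesh get the zero process
     as filler. *)
  have /choice[L HL] : forall k, exists L, (k < n.+1)%N ->
      [/\ isupermartingale P F L, \int[P]_x L 0%N x <= l0
        & forall s, {ae P, forall x,
            sub_exp_kernel c (S s x) (V s x) (t k.+1) <= L s x}].
    move=> k; case: (ltnP k n.+1) => [kn|]; last by exists (fun _ _ => 0).
    have lam0 : 0 <= (1 - t k.+1) / c.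
      by rewrite divr_ge0 ?(ltW c0)// subr_ge0 -t1 tle.
    have lam1 : (1 - t k.+1) / c < c^-1.
      by rewrite ltr_pdivrMr// mulVf ?gt_eqF// gtrBl divr_gt0.
    have [L [smL L0 LE]] := SVL _ lam0 lam1.
    exists L => _; split; last exact: LE.
      exact: supermartingale_isupermartingale fF smL.
    have [_ iL _] := smL.
    rewrite -lee_fin /Rintegral fineK; last exact: (integrable_fin_num _ (iL 0%N)).
    by move: L0; rewrite expectation.unlock.
  have sL k : (k < n.+1)%N -> isupermartingale P F (L k) by move=> /HL[].
  have [sM eM] := isupermartingale_sum fF W0 sL.
  pose M s x := \sum_(k < n.+1) W k * L k s x.
  (* Countably many times and tags allow a single exceptional null set. *)
  have dom : {ae P, forall x, forall s,
      \sum_(k < n.+1) W k * sub_exp_kernel c (S s x) (V s x) (t k.+1) <= M s x}.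
    apply/ae_foralln => s.
    have : {ae P, forall x, forall k, (k < n.+1)%N ->
        sub_exp_kernel c (S s x) (V s x) (t k.+1) <= L k s x}.
      apply/ae_foralln => k; have [kn|kn] := ltnP k n.+1.
        by have [_ _ /(_ s)] := HL k kn; apply: filterS.
      by apply: aeW.
    apply: filterS => x h; apply: ler_sum => -[k /= kn] _.
    by rewrite ler_wpM2l ?W0 ?h.
  have K0 s x : 0 <=
      \sum_(k < n.+1) W k * sub_exp_kernel c (S s x) (V s x) (t k.+1).
    by apply: sumr_ge0 => -[k /= kn] _; rewrite mulr_ge0 ?W0 ?expR_ge0.
  (* The level [a] reduced by the discretization factor: on [E] the finite mixture still reaches
     [b]. *)
  pose b := expR (- (B / n.+1%:R)) * a.
  have b0 : 0 < b by rewrite mulr_gt0 ?expR_gt0.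
  have := @ville _ _ _ P F M b fF sM _ b0.
  pose G := [set x | exists s, b <= M s x].
  have mG : measurable G.
    have -> : G = \bigcup_s (M s @^-1` `[b, +oo[).
      apply/seteqP; split => x /=.
        by move=> [s h]; exists s => //=; rewrite in_itv/= h.
      by move=> [s _ /=]; rewrite in_itv/= andbT => h; exists s.
    apply: bigcup_measurable => s _; rewrite -[X in measurable X]setTI.
    have [aM _ _] := sM; have [_ FT _] := fF.
    exact: (measurable_wrt_sub (FT s) (aM s)).
  have PEG : (P E <= P G)%E.
    apply: ae_le_measure => //; apply: filterS dom => x Mx /Ecross[s [S0 SB am]].
    exists s; apply: le_trans (Mx s).
    rewrite /b expRN ler_pdivrMl ?expR_gt0//.
    apply: (le_trans am); apply: le_trans (mixture_mesh c0 w0 iw n S0 (V0 s x)) _.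
    by apply: ler_wpM2r; [exact: K0|rewrite ler_expR ler_pM2r].
  move=> /(_ _)/le_trans vil.
  have {}vil : b * fine (P G) <= l0.
    rewrite -lee_fin EFinM fineK ?fin_num_measure//.
    apply: vil; first by move=> s; apply: filterS dom => x /(_ s); exact: le_trans.
    rewrite lee_fin eM -[leRHS]mul1r -W1 mulr_suml.
    by apply: ler_sum => -[k /= kn] _; rewrite ler_wpM2l ?W0//; have [] := HL k kn.
  apply: le_trans vil; rewrite /b -mulrA.
  apply: (@le_trans _ _ (expR (- (B / n.+1%:R)) * (a * fine (P E)))).
    by rewrite ler_wpM2r// expR_ge1Dx.
  rewrite ler_pM2l ?expR_gt0// ler_pM2l// fine_le ?fin_num_measure//.
(* With [N > B * X / e], the error [B * X / N] is below [e]. *)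
apply/ler_addgt0Pr => e e0; set X := a * fine (P E) in PE0 mesh *.
have := mesh (Num.truncn (B * X / e)).
have := truncnS_gt (B * X / e).
set N := _.+1%:R => BXN; have N0 : 0 < N by rewrite ltr0n.
rewrite mulrBl mul1r lerBlDr => /le_trans; apply.
by rewrite lerD2l mulrAC ler_pdivrMr// [e * N]mulrC -ler_pdivrMr// ltW.
Qed.

End mixture_ville.

(** * The gamma-exponential mixture *)

Section gamma_exponential_mixture.
Context {R : realType}.
Notation mu := (@lebesgue_measure R).
Context (c rho : R).
Hypotheses (c0 : 0 < c) (rho0 : 0 < rho).

Definition mixing_mass : R := \int[mu]_(u in `]0, 1])
  (u `^ (rho / c ^+ 2 - 1) * expR (- (rho / c ^+ 2 * u))).

Definition mixing_density (u : R) : R :=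
  mixing_mass^-1 * (u `^ (rho / c ^+ 2 - 1) * expR (- (rho / c ^+ 2 * u))).

Let a0 : 0 < rho / c ^+ 2. Proof. by rewrite divr_gt0 ?exprn_gt0. Qed.

Lemma mixing_mass_gt0 : 0 < mixing_mass.
Proof.
apply: Rintegral_gt0 => //.
- exact: integrable_powR_expR01 (ltW _).
- by move=> u; rewrite /= in_itv/= => /andP[u0 _]; rewrite mulr_gt0 ?powR_gt0 ?expR_gt0.
- by rewrite lebesgue_measure_itv/= lte_fin ltr01/= oppr0 adde0 eqe oner_neq0.
Qed.

Lemma mixing_density_gt0 u : 0 < u <= 1 -> 0 < mixing_density u.
Proof.
move=> /andP[u0 _].
by rewrite !mulr_gt0 ?invr_gt0 ?mixing_mass_gt0 ?powR_gt0 ?expR_gt0.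
Qed.

Lemma integrable_mixing_density :
  mu.-integrable `]0, 1] (EFin \o mixing_density).
Proof. by apply: integrable_EFinZl => //; exact: integrable_powR_expR01 (ltW _). Qed.

Lemma mixing_density1 : \int[mu]_(u in `]0, 1]) mixing_density u = 1.
Proof.
rewrite RintegralZl//; last exact: integrable_powR_expR01 (ltW _).
by rewrite mulVf// gt_eqF// mixing_mass_gt0.
Qed.

Lemma GE_mixE s v : 0 <= s -> 0 <= v ->
  GE_mix c rho s v = mixture c mixing_density s v.
Proof.
move=> s0 v0; rewrite /GE_mix.
have c2 : 0 < c ^+ 2 by rewrite exprn_gt0.
have a1 : 0 < (v + rho) / c ^+ 2 by rewrite divr_gt0// ltr_wpDl.
have b1 : 0 < (c * s + v + rho) / c ^+ 2.
  by rewrite divr_gt0// ltr_wpDl// addr_ge0// mulr_ge0// ltW.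
rewrite !Gamma_gamma_reg//.
(* The powers [A] and [B] produced by rescaling the two gamma integrals cancel against the explicit
   powers in [GE_mix]. *)
have ratioE (A Z B J x : R) : A != 0 -> Z != 0 -> B != 0 ->
    A / (A * Z) * (B * J / B) * x = Z^-1 * (x * J).
  by move=> A0 Z0 B0; field; rewrite A0 Z0 B0.
rewrite -/mixing_mass ratioE ?gt_eqF ?powR_gt0// ?mixing_mass_gt0//.
have iJ := integrable_powR_expR01 a1 (ltW b1).
have mI : measurable (`]0, 1] : set (measurableTypeR R)) by exact: measurable_itv.
rewrite -(RintegralZl _ mI iJ) -(RintegralZl _ mI (integrable_EFinZl _ mI iJ)).
apply: eq_Rintegral => u; rewrite inE/= in_itv/= => /andP[u0 _].
rewrite [RHS]mulrCA; congr *%R.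
rewrite sub_exp_kernelE ?gt_eqF//.
(* With every factor an exponential, the integrands agree by an identity of exponents, linear in
   [ln u]. *)
have uE (x : R) : u `^ x = expR (ln u * x) by rewrite expRM lnK.
rewrite !uE -!expRD; congr expR.
by field; rewrite gt_eqF.
Qed.

Lemma GEE l0 alpha v : 0 <= v ->
  GE c rho l0 alpha v = sup (mixture_sublevel c mixing_density (l0 / alpha) v).
Proof.
move=> v0; congr sup; apply/seteqP.
by split => s [s0 sL]; split => //; [rewrite -GE_mixE|rewrite GE_mixE].
Qed.

End gamma_exponential_mixture.

(** * Measurability and probability of the crossing event *)

Theorem proposition9 (R : realType) (c rho l0 alpha : R)
  (hc : 0 < c) (hrho : 0 < rho) (hl0 : 1 <= l0)
  (halpha0 : 0 < alpha) (halpha1 : alpha < 1) :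
  sub_exponential_uniform_boundary c l0 alpha (GE c rho l0 alpha).
Proof.
move=> d T P F S V SV crossing; have [fF [aS aV] _ V0 _] := SV.
have [_ FT _] := fF.
have w0 := mixing_density_gt0 hc hrho.
have iw := integrable_mixing_density hc hrho.
have mS t : measurable_fun setT (S t) by exact: measurable_wrt_sub (FT t) (aS t).
have mV t : measurable_fun setT (V t) by exact: measurable_wrt_sub (FT t) (aV t).
(* Monotonicity of the boundary is available for [v >= 0] only. Clamping extends it to the whole
   line, where it yields measurability, and changes nothing along [V]. *)
pose U v := GE c rho l0 alpha (Num.max 0 v).
have UV t x : U (V t x) = GE c rho l0 alpha (V t x) by rewrite /U max_r.
have mU : measurable_fun setT U.
  apply: nondecreasing_measurable => // v v' vv.
  have pos (x : R) : 0 <= Num.max 0 x by rewrite le_max lexx.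
  rewrite /U (GEE hc hrho _ _ (pos v)) (GEE hc hrho _ _ (pos v')).
  apply: (sup_mixture_sublevel_homo hc w0 iw _ (pos v)).
  by rewrite ge_max !le_max lexx vv orbT.
(* Crossings at which [S / c + V / c^2] is at most [k]: the bound [mixture_bounded_crossing] needs,
   in sets increasing to the crossing event. *)
pose E (k : nat) := \bigcup_(t in [set t | (1 <= t)%N])
  ([set x | U (V t x) <= S t x] `&` [set x | S t x / c + V t x / c ^+ 2 <= k%:R]).
have mE k : measurable (E k).
  apply: bigcup_measurable => t _; apply: measurableI.
    rewrite -[X in measurable X]setTI.
    by apply: measurable_fun_le => //; exact: measurableT_comp.
  rewrite -[X in measurable X]setTI.
  apply: measurable_fun_le => //.
  by apply: measurable_funD; exact: measurable_funM.
have crossE : crossing = \bigcup_k E k.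
  apply/seteqP; split => x /=.
    move=> [t t1 h]; exists (Num.truncn (S t x / c + V t x / c ^+ 2)).+1 => //.
    by exists t => //; split; rewrite /= ?UV// ltW// truncnS_gt.
  by move=> [k _ [t t1 [/=]]]; rewrite UV; exists t.
have L0 : 0 < l0 / alpha by rewrite divr_gt0// (lt_le_trans _ hl0).
have PE k : (P (E k) <= alpha%:E)%E.
  have : l0 / alpha * fine (P (E k)) <= l0.
    apply: (mixture_bounded_crossing hc w0 iw (mixing_density1 hc hrho) SV L0
      (ler0n R k) (mE k)).
    move=> x [t _ [/= h1 h2]]; exists t.
    have := h1; rewrite UV (GEE hc hrho _ _ (V0 t x)) => sup_le.
    have [S0 mL] := le_mixture_sup hc w0 iw (V0 t x) sup_le.
    split; [exact: S0|exact: h2|exact: mL].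
  rewrite -mulrA -[leRHS]mulr1 ler_pM2l ?(lt_le_trans ltr01)//.
  rewrite ler_pdivrMl// mulr1 => h.
  by rewrite -[P _]fineK ?lee_fin// fin_num_measure.
rewrite crossE; have mUE : measurable (\bigcup_k E k) by exact: bigcup_measurable.
split => //.
have cvgE : P (E k) @[k --> \oo] --> P (\bigcup_k E k).
  apply: nondecreasing_cvg_mu => // m n mn; apply/subsetPset => x [t t1 [h1 h2]].
  by exists t => //; split => //=; apply: le_trans h2 _; rewrite ler_nat.
by apply: cvge_le cvgE; exact: nearW.
Qed.
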